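(* Let $X$ be a compactum (compact Hausdorff space) such that the map $\beta^\cdot_{A^\cdot X}:A^\cdot(A^\cdot X)\to A^\cdot X$ is soft. Then $X$ is metrizable.
   Context: All maps are continuous. A map $f:X\to Y$ is soft if for any paracompact space $Z$, any closed subspace $A$ of $Z$ and maps $\Phi:A\to X$ and $\Psi:Z\to Y$ with $\Psi|_A=f\circ\Phi$ there exists a map $G:Z\to X$ such that $G|_A=\Phi$ and $\Psi=f\circ G$. $C(X,[0,1])$ is the set of continuous functions $X\to[0,1]$ on a compactum $X$, $\vee$ is the pointwise maximum, $c_X$ the constant function with value $c$. $A^\cdot X=A^\cdot(X)$ is the set of $\cdot$-measures: functionals $\mu:C(X,[0,1])\to[0,1]$ with $\mu(1_X)=1$, $\mu(\lambda_X\cdot\varphi)=\lambda\cdot\mu(\varphi)$ for $\lambda\in[0,1]$, $\varphi\in C(X,[0,1])$, and $\mu(\psi\vee\varphi)=\mu(\psi)\vee\mu(\varphi)$ for $\psi,\varphi\in C(X,[0,1])$; it is topologized as a subspace of $[0,1]^{C(X,[0,1])}$ (product topology). A subset $K\subset[0,1]^T$ is max-$\cdot$ convex if $\lambda\cdot a\vee b\in K$ for all $a,b\in K$, $\lambda\in[0,1]$ (coordinatewise operations, $\cdot$ having priority over $\vee$). It is known that $A^\cdot X$ is a compact max-$\cdot$ convex subset of $[0,1]^{C(X,[0,1])}$. For a compact max-$\cdot$ convex $K\subset[0,1]^T$, the barycenter map $\beta^\cdot_K:A^\cdot(K)\to K$ is defined by letting the $t$-th coordinate of $\beta^\cdot_K(\mu)$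 be $\mu(\mathrm{pr}_t|_K)$, where $\mathrm{pr}_t:[0,1]^T\to[0,1]$ is the $t$-th projection. (It is known that $\beta^\cdot_K$ is a well-defined continuous map into $K$.) In the claim, $K=A^\cdot X$ and $T=C(X,[0,1])$. *)

(* Defs.v *)
From HB Require Import structures.
From mathcomp Require Import all_boot all_order all_algebra.
From mathcomp Require Import all_classical all_reals all_analysis.
Import Order.TTheory GRing.Theory Num.Theory.
Import numFieldNormedType.Exports.

Set Implicit Arguments.
Unset Strict Implicit.
Unset Printing Implicit Defensive.

Local Open Scope classical_set_scope.
Local Open Scope ring_scope.

Section topological_notions.
Implicit Types X Y Z T : topologicalType.

Definition locally_finite T (V : set (set T)) : Prop :=
  forall x : T, exists2 U, nbhs x U &
    finite_set [set W | V W /\ W `&` U !=set0].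

(* Paracompact spaces are Hausdorff by convention. *)
Definition paracompact T : Prop :=
  hausdorff_space T /\
  forall U : set (set T), U `<=` open -> cover U id = [set: T] ->
    exists V : set (set T),
      [/\ V `<=` open,
          cover V id = [set: T],
          (forall W, V W -> exists2 W', U W' & W `<=` W') &
          locally_finite V].

Definition soft X Y (f : continuousType X Y) : Prop :=
  forall (Z : topologicalType) (A : set Z), paracompact Z -> closed A ->
  forall (Phi : continuousType A X) (Psi : continuousType Z Y),
    (forall a : A, Psi (set_val a) = f (Phi a)) ->
    exists G : continuousType Z X,
      (forall a : A, G (set_val a) = Phi a) /\
      (forall z : Z, Psi z = f (G z)).

Definition metrizable (R : realType) X : Prop :=
  exists d : X -> X -> R,
    [/\ (forall x y, d x y = 0 <-> x = y),
        (forall x y, d x y = d y x),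
        (forall x y z, d x z <= d x y + d y z) &
        (forall x, nbhs x = nbhs_ball_ (fun x e => [set y | d x y < e]) x)].

End topological_notions.

Section unit_interval.
Variable R : realType.

Definition unit_interval : set R := [set x | 0 <= x <= 1].
Local Notation I := (set_type unit_interval).

Definition mk01 (x : R) (x01 : 0 <= x <= 1) : I :=
  SigSub (mem_set x01 : x \in unit_interval).

Definition one01 : I := @mk01 1 (introT andP (conj ler01 (lexx 1))).

Lemma mul01_subproof (a b : I) : 0 <= set_val a * set_val b <= 1.
Proof.
have /andP[a0 a1] := set_valP a; have /andP[b0 b1] := set_valP b.
by rewrite mulr_ge0 //= mulr_ile1.
Qed.

Definition mul01 (a b : I) : I := mk01 (mul01_subproof a b).

Lemma max01_subproof (a b : I) : 0 <= Num.max (set_val a) (set_val b) <= 1.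
Proof.
have /andP[a0 a1] := set_valP a; have /andP[b0 b1] := set_valP b.
by rewrite le_max a0 /= ge_max a1 b1.
Qed.

Definition max01 (a b : I) : I := mk01 (max01_subproof a b).

Lemma continuous_set_val01 : continuous (set_val : I -> R).
Proof. exact: initial_continuous. Qed.

Lemma continuous_into01 (T : topologicalType) (f : T -> I) :
  continuous (fun x => set_val (f x)) -> continuous f.
Proof. by move=> cf; apply: continuous_comp_initial. Qed.

End unit_interval.
Arguments unit_interval : clear implicits.

Notation I01 R := (set_type (unit_interval R)).
Notation C01 R X := (continuousType X (I01 R)).
Notation cube R T := {ptws T -> I01 R}.

Section functions.
Variables (R : realType) (X : topologicalType).
Implicit Types (l : I01 R) (phi psi : C01 R X).

Lemma continuous_val_comp phi : continuous (fun x => set_val (phi x)).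
Proof.
move=> x; apply: (@continuous_comp _ _ _ phi); first exact: cts_fun.
exact: continuous_set_val01.
Qed.

Lemma scale_fun_subproof l phi : continuous (fun x => mul01 l (phi x)).
Proof.
apply: continuous_into01 => x /=.
by apply: cvgM; [exact: cvg_cst | exact: continuous_val_comp].
Qed.

Definition scale_fun l phi : C01 R X := mkcts (@scale_fun_subproof l phi).

Lemma max_fun_subproof psi phi : continuous (fun x => max01 (psi x) (phi x)).
Proof.
apply: continuous_into01 => x /=.
by apply: (@continuous_max R X (fun x => set_val (psi x))
  (fun x => set_val (phi x))); exact: continuous_val_comp.
Qed.

Definition max_fun psi phi : C01 R X := mkcts (@max_fun_subproof psi phi).

(* As a set of points of the cube, its coercion to a type carries the subspace
   topology of the product topology. *)
Definition maxprod_measures : set (cube R (C01 R X)) :=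
  [set mu : cube R (C01 R X) | [/\ mu (cst (one01 R)) = one01 R,
    (forall l phi, mu (scale_fun l phi) = mul01 l (mu phi)) &
    (forall psi phi, mu (max_fun psi phi) = max01 (mu psi) (mu phi))]].

End functions.

Arguments maxprod_measures : clear implicits.

Notation Adot R X := (set_type (maxprod_measures R X)).

Section barycenter.
Variable R : realType.

Section general.
Variables (T : eqType) (K : set (cube R T)).

Lemma restr_proj_subproof (t : T) :
  continuous (fun a : K => (set_val a : cube R T) t).
Proof.
move=> a; apply: (@continuous_comp _ _ _ (set_val : K -> cube R T) (proj t)).
  exact: initial_continuous.
exact: proj_continuous.
Qed.

Definition restr_proj (t : T) : C01 R K := mkcts (@restr_proj_subproof t).

(* For compact max-times convex [K] the barycenter lies in [K]; in general it
   is only a point of the ambient cube. *)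
Definition barycenter (mu : Adot R K) : cube R T :=
  fun t => (set_val mu : cube R (C01 R K)) (restr_proj t).

Lemma continuous_barycenter : continuous barycenter.
Proof.
move=> mu; have F : Filter (barycenter x @[x --> mu]) by apply: fmap_filter; exact: nbhs_filter.
apply/cvg_sup => t.
have c : continuous (fun mu : Adot R K => barycenter mu t).
  move=> nu; apply: (@continuous_comp _ _ _
    (set_val : Adot R K -> cube R (C01 R K)) (proj (restr_proj t))).
    exact: initial_continuous.
  exact: proj_continuous.
exact: (@continuous_comp_initial _ _ _ (fun f : cube R T => f t) barycenter c mu).
Qed.

End general.

Variable X : topologicalType.

Lemma barycenter_maxprod (M : Adot R (Adot R X)) :
  barycenter M \in maxprod_measures R X.
Proof.
have [M1 MZ MU] := set_valP M; rewrite inE; split.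
- rewrite /barycenter -[RHS]M1; congr (set_val M _).
  by apply/continuousEP => nu; have [] := set_valP nu.
- move=> l phi; rewrite /barycenter -MZ; congr (set_val M _).
  by apply/continuousEP => nu; have [_ + _] := set_valP nu; apply.
- move=> psi phi; rewrite /barycenter -MU; congr (set_val M _).
  by apply/continuousEP => nu; have [_ _] := set_valP nu; apply.
Qed.

Definition barycenter_map_fun (M : Adot R (Adot R X)) : Adot R X :=
  SigSub (barycenter_maxprod M).

Lemma barycenter_map_subproof : continuous barycenter_map_fun.
Proof. by apply: continuous_comp_initial; exact: continuous_barycenter. Qed.

Definition barycenter_map : continuousType (Adot R (Adot R X)) (Adot R X) :=
  mkcts barycenter_map_subproof.

End barycenter.
Arguments barycenter_map : clear implicits.

(* Main.v *)
Require Import Defs.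
From mathcomp Require Import all_boot all_order all_algebra.
From mathcomp Require Import all_classical all_reals all_analysis.
From mathcomp Require Import lra.
Import Order.TTheory GRing.Theory Num.Theory.
Import numFieldNormedType.Exports.

Set Implicit Arguments.
Unset Strict Implicit.
Unset Printing Implicit Defensive.

Local Open Scope classical_set_scope.
Local Open Scope ring_scope.

(** Softness is applied to the square over [X * X * X]: on the closed set where
    [w = x] or [w = y] the measure on measures with atoms [dx v dw] and [dy]
    ([dx] being the Dirac measure at [x]) lies over [dx v dy], so these measures
    extend to a continuous family [G (x, y, w)] over [dx v dy]. Testing
    [G (x, y, w)] against [nu |-> nu u * nu (1 - u)], where [u] is [1] at [x] and
    [0] at [y], measures to what extent [G (x, y, w)] charges measures that
    mix [x] and [y]; the value is [0] at [w = x] and [1] at [w = y], and up to a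
    factor [4] it does not depend on [u]. A countable closing-off argument then
    yields countably many functions [f] and points [q] such that the [f]
    separate the [q] from each other, and separate [x] from [w] whenever the
    [f] allow a [u] that is [1] at [x], [0] at [q], with value at least [1/8] at
    [(x, q, w)]. If the [f] did not separate [a] and [b], some of the points [q]
    would be close to a point [z] of the class of [a] without belonging to that
    class. With [y] another point of the class, the value at [(y, q, z)] is near
    the value [1] at [(y, z, z)], so the [f] separate [y] from [z], a
    contradiction. *)

(** * Compactness, paracompactness and products *)

Lemma compact_finite_cover (X : topologicalType) (I : eqType) (U : I -> set X)
    (K : set X) :
  compact K -> (forall i, open (U i)) -> (forall x, K x -> exists i, U i x) ->
  exists s : seq I, forall x, K x -> exists2 i, i \in s & U i x.
Proof.
move=> /compact_near_coveringP cK oU KU.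
(* [F] consists of the properties that hold for all large enough finite lists. The near-covering
   form of compactness along [F] turns local coverings by one index into a single list for all of
   [K]. *)
pose F := [set P : set (seq I) | exists s : seq I,
  forall t : seq I, {subset s <= t} -> P t].
have FF : Filter F.
  split.
  - by exists [::].
  - move=> P Q [s sP] [t tQ]; exists (s ++ t) => r str; split.
      by apply: sP => i si; apply: str; rewrite mem_cat si.
    by apply: tQ => i ti; apply: str; rewrite mem_cat ti orbT.
  - by move=> P Q PQ [s sP]; exists s => t /sP /PQ.
have [|s sP] := cK _ F (fun s x => exists2 i, i \in s & U i x) FF.
  move=> x /KU [i Ux].
  exists (U i, [set t | i \in t]) => /=.
    split; first exact: open_nbhs_nbhs.
    by exists [:: i] => t; apply; rewrite inE.
  by move=> [y t] /= [Uy it]; exists i.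
by exists s; exact: sP.
Qed.

(** A finite subcover is a locally finite refinement. This admits [X * X * X] as a test space for
    softness. *)
Lemma compact_hausdorff_paracompact (X : topologicalType) :
  compact [set: X] -> hausdorff_space X -> paracompact X.
Proof.
move=> cX hX; split=> // U Uo covU.
(* The cover is indexed by all subsets of [X]; those outside [U] contribute the empty set, so every
   index gives an open set. *)
pose O (W : set X) := [set x | U W /\ W x].
have Oo W : open (O W).
  have [UW|nUW] := pselect (U W).
    rewrite (_ : O W = W); first exact: Uo.
    by apply/seteqP; split=> x; [case | split].
  rewrite (_ : O W = set0); first exact: open0.
  by apply/seteqP; split=> x // [].
have Ocov x : [set: X] x -> exists W, O W x.
  move=> _; have : cover U id x by rewrite covU.
  by case=> W UW Wx; exists W.
have [s sP] := compact_finite_cover cX Oo Ocov.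
exists [set W | W \in s /\ U W]; split.
- by move=> W [_ /Uo].
- apply/seteqP; split=> // x _.
  by have [W sW [UW Wx]] := sP x I; exists W.
- by move=> W [_ UW]; exists W.
- move=> x; exists setT; first exact: filterT.
  apply: (sub_finite_set _ (finite_seq s)).
  by move=> W [[]].
Qed.

Lemma hausdorff_prod (X Y : topologicalType) :
  hausdorff_space X -> hausdorff_space Y -> hausdorff_space (X * Y)%type.
Proof.
move=> hX hY [x y] [x' y'] cl; congr pair.
  apply: hX => A B nA nB.
  have [||[a b] [/= Aa Ba]] := cl (A `*` setT) (B `*` setT).
  - by exists (A, setT) => //; split=> //; exact: filterT.
  - by exists (B, setT) => //; split=> //; exact: filterT.
  by exists a; split; [case: Aa | case: Ba].
apply: hY => A B nA nB.
have [||[a b] [/= Aa Ba]] := cl (setT `*` A) (setT `*` B).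
- by exists (setT, A) => //; split=> //; exact: filterT.
- by exists (setT, B) => //; split=> //; exact: filterT.
by exists b; split; [case: Aa | case: Ba].
Qed.

Lemma closed_eq_fun (X Y : topologicalType) (f g : X -> Y) :
  hausdorff_space Y -> continuous f -> continuous g ->
  closed [set x | f x = g x].
Proof.
move=> hY cf cg x clx; apply: hY => A B nA nB.
have nfA : nbhs x (f @^-1` A) by exact: cf.
have ngB : nbhs x (g @^-1` B) by exact: cg.
have [y [/= fg [Ay By]]] := clx _ (filterI nfA ngB).
by exists (f y); split=> //; rewrite fg.
Qed.

Lemma continuous_pair (X Y Z : topologicalType) (f : X -> Y) (g : X -> Z) :
  continuous f -> continuous g -> continuous (fun x => (f x, g x)).
Proof. by move=> cf cg x; apply: cvg_pair; [exact: cf | exact: cg]. Qed.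

Lemma continuous_fst (X Y : topologicalType) :
  continuous (fst : X * Y -> X).
Proof. by move=> [x y]; exact: cvg_fst. Qed.

Lemma continuous_snd (X Y : topologicalType) :
  continuous (snd : X * Y -> Y).
Proof. by move=> [x y]; exact: cvg_snd. Qed.

Lemma continuous_o (X Y Z : topologicalType) (f : X -> Y) (g : Y -> Z) :
  continuous f -> continuous g -> continuous (fun x => g (f x)).
Proof. by move=> cf cg x; apply: continuous_comp; [exact: cf|exact: cg]. Qed.

(** * Real functions, truncation to the unit interval, Urysohn functions *)

Section real_functions.
Variables (R : realType) (X : topologicalType).
Implicit Types f : X -> R.

Lemma open_lt_fun f (r : R) : continuous f -> open [set x | f x < r].
Proof. by move=> /continuousP cf; apply: (cf [set y | y < r]); exact: open_lt. Qed.

Lemma open_gt_fun f (r : R) : continuous f -> open [set x | r < f x].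
Proof. by move=> /continuousP cf; apply: (cf [set y | r < y]); exact: open_gt. Qed.

Lemma closed_ge_fun f (r : R) : continuous f -> closed [set x | r <= f x].
Proof.
by move=> /continuous_closedP cf; apply: (cf [set y | r <= y]); exact: closed_ge.
Qed.

Lemma clamp_subproof (r : R) : 0 <= Num.max 0 (Num.min 1 r) <= 1.
Proof. by rewrite le_max lexx ge_max ler01 /= ge_min lexx. Qed.

Definition clamp r : I01 R := mk01 (clamp_subproof r).

Lemma clampE r : 0 <= r <= 1 -> set_val (clamp r) = r.
Proof. case/andP=> r0 r1; change (Num.max 0 (Num.min 1 r) = r).
by rewrite (min_idPr r1) (max_idPr r0). Qed.

Lemma clamp_fun_subproof f : continuous f -> continuous (fun x => clamp (f x)).
Proof.
move=> cf; apply: continuous_into01 => x.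
apply: (@continuous_max R X (fun=> 0) (fun x => Num.min 1 (f x))).
  exact: cst_continuous.
by apply: (@continuous_min R X (fun=> 1) f); [exact: cst_continuous|exact: cf].
Qed.

Definition clamp_fun f (cf : continuous f) : C01 R X :=
  mkcts (clamp_fun_subproof cf).

End real_functions.

Lemma hausdorff_separation (R : realType) (X : topologicalType) (x y : X) :
  compact [set: X] -> hausdorff_space X -> x <> y ->
  exists f : C01 R X, set_val (f x) = 1 /\ set_val (f y) = 0.
Proof.
move=> cX hX xy.
have nX := compact_normal hX cX.
have c1 := accessible_closed_set1 (hausdorff_accessible hX).
have d0 : [set y] `&` [set x] = set0.
  by apply/seteqP; split=> z //= [-> /esym].
have := normal_uniform_separator nX (c1 y) (c1 x) d0.
move=> /(@uniform_separatorP X R) [f [cf f01 f0 f1]].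
have fr z : 0 <= f z <= 1.
  by have := f01 (f z) (ex_intro2 _ _ z I erefl); rewrite /= in_itv.
exists (clamp_fun cf); split.
  by rewrite -[RHS](f1 (f x)); [exact: clampE | exists x].
by rewrite -[RHS](f0 (f y)); [exact: clampE | exists y].
Qed.

Lemma val01 (R : realType) (a : I01 R) : 0 <= set_val a <= 1.
Proof. exact: (set_valP a). Qed.

(** * Evaluation of measures and joins of Dirac measures *)

Section measures.
Variables (R : realType) (Y : topologicalType).
Implicit Types (mu : Adot R Y) (phi psi : C01 R Y).

Definition meas mu phi : R := set_val ((set_val mu : cube R (C01 R Y)) phi).

Lemma continuous_meas phi : continuous (fun mu => meas mu phi).
Proof.
apply: continuous_o (@continuous_set_val01 R).
apply: (@continuous_o _ (cube R (C01 R Y)) _ set_val (fun f => f phi)).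
  exact: initial_continuous.
exact: (@proj_continuous _ _ phi).
Qed.

Lemma meas01 mu phi : 0 <= meas mu phi <= 1.
Proof. exact: val01. Qed.

Lemma meas_max mu psi phi :
  meas mu (max_fun psi phi) = Num.max (meas mu psi) (meas mu phi).
Proof. by have [_ _ U] := set_valP mu; exact: (congr1 set_val (U psi phi)). Qed.

Lemma meas_scale mu l phi : meas mu (scale_fun l phi) = set_val l * meas mu phi.
Proof. by have [_ Z _] := set_valP mu; exact: (congr1 set_val (Z l phi)). Qed.

Lemma val01_inj : injective (set_val : I01 R -> R).
Proof. exact: val_inj. Qed.

Lemma meas_le mu phi psi :
  (forall y, set_val (phi y) <= set_val (psi y)) -> meas mu phi <= meas mu psi.
Proof.
move=> le; have E : max_fun phi psi = psi.
  by apply/continuousEP => y; apply: val01_inj; exact: (max_idPr (le y)).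
by rewrite -[in leRHS]E meas_max le_max lexx.
Qed.

(** Measures respect maxima and scalings but not sums, so every later estimate between functions is
    brought to this form. *)
Lemma meas_scale_le mu (c : R) phi psi : 0 <= c <= 1 ->
  (forall y, c * set_val (phi y) <= set_val (psi y)) ->
  c * meas mu phi <= meas mu psi.
Proof.
by move=> c01 le; rewrite -[c]/(set_val (mk01 c01)) -meas_scale; exact: meas_le.
Qed.

Lemma continuous_into_measures (Z : topologicalType) (f : Z -> Adot R Y) :
  (forall phi, continuous (fun z => meas (f z) phi)) -> continuous f.
Proof.
move=> cf.
apply: continuous_comp_initial => z.
have F : Filter ((set_val \o f) x @[x --> z]).
  by apply: fmap_filter; exact: nbhs_filter.
apply/cvg_sup => phi.
have c : continuous (fun z => (set_val (f z) : cube R (C01 R Y)) phi).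
  by apply: continuous_into01; exact: cf.
exact: (@continuous_comp_initial _ _ _ (fun g : cube R (C01 R Y) => g phi)
  (set_val \o f) c z).
Qed.

Lemma pair_meas_subproof (a b : Y) :
  ((fun phi => max01 (phi a) (phi b)) : cube R (C01 R Y))
    \in maxprod_measures R Y.
Proof.
rewrite inE; split=> [|l phi|psi phi]; apply: val01_inj => /=.
- exact: max_idPl.
- have /andP[l0 _] := set_valP l; symmetry.
  exact: (maxr_pMr (set_val (phi a)) (set_val (phi b)) l0).
- exact: (maxACA (set_val (psi a)) (set_val (phi a))
    (set_val (psi b)) (set_val (phi b))).
Qed.

(* The join of the Dirac measures at [a] and [b]. *)
Definition pair_meas (a b : Y) : Adot R Y := SigSub (pair_meas_subproof a b).

Lemma pair_measE a b phi :
  meas (pair_meas a b) phi = Num.max (set_val (phi a)) (set_val (phi b)).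
Proof. by []. Qed.

Lemma continuous_pair_meas (Z : topologicalType) (f g : Z -> Y) :
  continuous f -> continuous g -> continuous (fun z => pair_meas (f z) (g z)).
Proof.
move=> cf cg; apply: continuous_into_measures => phi.
have cp : continuous (fun y => set_val (phi y)) by exact: continuous_val_comp.
move=> z; apply: (@continuous_max R Z (fun z => set_val (phi (f z)))
  (fun z => set_val (phi (g z)))).
  exact: (continuous_o cf cp).
exact: (continuous_o cg cp).
Qed.

End measures.

(** * Test functions on the space of measures *)

Lemma mul_half_le_max (R : realFieldType) (a b c d e : R) :
  0 <= a <= 1 -> 0 <= b <= 1 -> 0 <= c <= 1 -> 0 <= d <= 1 ->
  a / 2 <= Num.max c e -> b / 2 <= Num.max d e ->
  4^-1 * (a * b) <= Num.max (c * d) e.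
Proof.
move=> /andP[a0 a1] /andP[b0 b1] /andP[c0 c1] /andP[d0 d1].
have aba : a * b <= a by exact: ler_piMr.
have abb : a * b <= b by exact: ler_piMl.
have ab0 : 0 <= a * b by exact: mulr_ge0.
(* If [c] and [d] realise the two maxima, the bounds multiply; otherwise [e] is at least half of [a]
   or of [b], each of which is at least [a * b]. *)
rewrite !le_max => /orP[le1|le1] /orP[le2|le2]; apply/orP; [left|right..]; try lra.
rewrite mulrC (_ : 4^-1 = 2^-1 * 2^-1); last by rewrite -invfM -natrM.
by rewrite mulrACA ler_pM // divr_ge0.
Qed.

Section test_functions.
Variables (R : realType) (X : topologicalType).
Implicit Types (u v : C01 R X) (x y : X).

Lemma continuous_val u : continuous (fun x => set_val (u x)).
Proof. exact: continuous_val_comp. Qed.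

Lemma compl_subproof u : continuous (fun x => 1 - set_val (u x)).
Proof.
move=> x; apply: (@continuousB _ R^o _ (fun=> 1) (fun x => set_val (u x))).
  exact: cst_continuous.
exact: continuous_val.
Qed.

Definition compl u : C01 R X := clamp_fun (@compl_subproof u).

Lemma complE u x : set_val (compl u x) = 1 - set_val (u x).
Proof.
by apply: clampE; have /andP[] := val01 (u x) => u0 u1; apply/andP; split; lra.
Qed.

Lemma gap_subproof u v : continuous (fun x => `|set_val (u x) - set_val (v x)|).
Proof.
apply: (@continuous_o _ _ _ (fun x => set_val (u x) - set_val (v x)) Num.norm).
  by move=> x; apply: (@continuousB _ R^o _ (fun x => set_val (u x))
       (fun x => set_val (v x))); exact: continuous_val.
exact: norm_continuous.
Qed.

Definition gap u v : C01 R X := clamp_fun (@gap_subproof u v).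

Lemma gapE u v x : set_val (gap u v x) = `|set_val (u x) - set_val (v x)|.
Proof.
apply: clampE; have /andP[] := val01 (u x) => u0 u1.
have /andP[] := val01 (v x) => v0 v1.
by rewrite normr_ge0 ler_norml; apply/andP; split; lra.
Qed.

Lemma test_subproof u :
  continuous (fun nu : Adot R X => meas nu u * meas nu (compl u)).
Proof.
move=> nu; apply: (@continuousM R (Adot R X) (fun nu => meas nu u)
  (fun nu => meas nu (compl u))); exact: continuous_meas.
Qed.

Definition test u : C01 R (Adot R X) := clamp_fun (@test_subproof u).

Lemma testE u nu : set_val (test u nu) = meas nu u * meas nu (compl u).
Proof.
apply: clampE; have /andP[a0 a1] := meas01 nu u.
have /andP[b0 b1] := meas01 nu (compl u).
by rewrite mulr_ge0 // mulr_ile1.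
Qed.

Lemma meas_barycenter (M : Adot R (Adot R X)) u :
  meas (barycenter_map R X M) u = meas M (restr_proj (maxprod_measures R X) u).
Proof. by []. Qed.

(** Pointwise [u <= v + w], and a sum is at most twice the maximum; the factor 2 is the price of
    having no additivity. *)
Lemma meas_half_le (nu : Adot R X) u v (w : C01 R X) :
  (forall x, `|set_val (u x) - set_val (v x)| <= set_val (w x)) ->
  meas nu u / 2 <= Num.max (meas nu v) (meas nu w).
Proof.
move=> uvw; rewrite -meas_max mulrC; apply: meas_scale_le.
  by apply/andP; split; lra.
move=> x; have := uvw x; rewrite ler_norml => /andP[_ le].
change (2^-1 * set_val (u x) <= Num.max (set_val (v x)) (set_val (w x))).
by rewrite le_max; apply/orP; have [|] := leP (set_val (v x)) (set_val (w x));
  [right|left]; lra.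
Qed.

(* All measures charged by [M] are carried by [{x, y}], where [u] and [v] agree. *)
Lemma meas_test_le (M : Adot R (Adot R X)) x y u v :
  barycenter_map R X M = pair_meas R x y ->
  set_val (u x) = set_val (v x) -> set_val (u y) = set_val (v y) ->
  meas M (test u) / 4 <= meas M (test v).
Proof.
move=> bM ux uy; pose w := gap u v.
have Mw : meas M (restr_proj (maxprod_measures R X) w) = 0.
  by rewrite -meas_barycenter bM pair_measE !gapE ux uy !subrr normr0 maxxx.
(* Joining a function on which [M] vanishes does not change the value of [M], so a pointwise bound
   up to that function suffices. *)
have -> : meas M (test v) =
    meas M (max_fun (test v) (restr_proj (maxprod_measures R X) w)).
  rewrite meas_max Mw; symmetry; apply/max_idPl.
  by have /andP[] := meas01 M (test v).
rewrite mulrC; apply: meas_scale_le; first by apply/andP; split; lra.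
move=> nu; change (4^-1 * set_val (test u nu) <=
  Num.max (set_val (test v nu)) (meas nu w)); rewrite !testE.
have le1 : meas nu u / 2 <= Num.max (meas nu v) (meas nu w).
  by apply: meas_half_le => z; rewrite gapE.
have le2 : meas nu (compl u) / 2 <= Num.max (meas nu (compl v)) (meas nu w).
  apply: meas_half_le => z; rewrite gapE !complE.
  by rewrite opprB addrC addrA subrK distrC.
exact: mul_half_le_max (meas01 _ _) (meas01 _ _) (meas01 _ _) (meas01 _ _)
  le1 le2.
Qed.

End test_functions.

(** * The lifted family obtained from softness *)

Lemma barycenter_pair_meas (R : realType) (X : topologicalType) (x y w : X) :
  w = x \/ w = y ->
  barycenter_map R X (pair_meas R (pair_meas R x w) (pair_meas R y y)) =
  pair_meas R x y.
Proof.
move=> xyw; apply: val_inj; apply/funext => phi; apply: val01_inj.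
change (Num.max (Num.max (set_val (phi x)) (set_val (phi w)))
  (Num.max (set_val (phi y)) (set_val (phi y))) =
  Num.max (set_val (phi x)) (set_val (phi y))).
by case: xyw => ->; rewrite maxxx ?maxxx // -maxA maxxx.
Qed.

Lemma soft_barycenter_section (R : realType) (X : topologicalType) :
  compact [set: X] -> hausdorff_space X -> soft (barycenter_map R X) ->
  exists G : X * X * X -> Adot R (Adot R X),
    [/\ continuous G,
      forall x y w, barycenter_map R X (G (x, y, w)) = pair_meas R x y,
      forall x y, G (x, y, x) =
        pair_meas R (pair_meas R x x) (pair_meas R y y) &
      forall x y, G (x, y, y) =
        pair_meas R (pair_meas R x y) (pair_meas R y y)].
Proof.
move=> cX hX sX; pose A := [set z : X * X * X | z.2 = z.1.1 \/ z.2 = z.1.2].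
have cZ : compact [set: X * X * X].
  by rewrite -!setXTT; apply: compact_setX => //; exact: compact_setX.
have hZ : hausdorff_space (X * X * X)%type by do 2 apply: hausdorff_prod => //.
have c1 : continuous (fun z : X * X * X => z.1.1).
  exact: (continuous_o (@continuous_fst _ _) (@continuous_fst _ _)).
have c2 : continuous (fun z : X * X * X => z.1.2).
  exact: (continuous_o (@continuous_fst _ _) (@continuous_snd _ _)).
have c3 : continuous (fun z : X * X * X => z.2) by exact: continuous_snd.
have cA : closed A by apply: closedU; exact: closed_eq_fun.
(* The formula is continuous on the whole cube of [X]; [barycenter_pair_meas] places it over
   [dx v dy] on [A]. *)
pose PhiZ z : Adot R (Adot R X) :=
  pair_meas R (pair_meas R z.1.1 z.2) (pair_meas R z.1.2 z.1.2).
have cPhiZ : continuous PhiZ.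
  by apply: continuous_pair_meas; exact: continuous_pair_meas.
have cPhi : continuous (fun a : A => PhiZ (set_val a)).
  apply: (continuous_o _ cPhiZ); exact: initial_continuous.
have cPsi : continuous (fun z : X * X * X => pair_meas R z.1.1 z.1.2).
  exact: continuous_pair_meas.
have [|G [GA GZ]] := sX _ A (compact_hausdorff_paracompact cZ hZ) cA
  (mkcts cPhi) (mkcts cPsi).
  by case=> z Az; symmetry; apply: barycenter_pair_meas; exact: (set_mem Az).
exists G; split.
- exact: cts_fun.
- by move=> x y w; rewrite -GZ.
- move=> x y; have Az : (x, y, x) \in A by rewrite inE; left.
  exact: (GA (SigSub Az)).
- move=> x y; have Az : (x, y, y) \in A by rewrite inE; right.
  exact: (GA (SigSub Az)).
Qed.

(** [e u z] is the value of [G z] at [test u]; the rest of the proof uses only these four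
    properties. [test u] is 0 at [dx] and [dy], the atoms for [w = x], and 1 at the atom [dx v dy]
    present for [w = y]. *)
Lemma soft_barycenter_kernel (R : realType) (X : topologicalType) :
  compact [set: X] -> hausdorff_space X -> soft (barycenter_map R X) ->
  exists e : C01 R X -> X * X * X -> R,
    [/\ forall u : C01 R X, continuous (e u),
      forall (u : C01 R X) x y, set_val (u x) = 1 -> set_val (u y) = 0 ->
        e u (x, y, x) = 0,
      forall (u : C01 R X) x y, set_val (u x) = 1 -> set_val (u y) = 0 ->
        e u (x, y, y) = 1 &
      forall (u v : C01 R X) x y w, set_val (u x) = set_val (v x) ->
        set_val (u y) = set_val (v y) -> e u (x, y, w) / 4 <= e v (x, y, w)].
Proof.
move=> cX hX sX; have [G [cG bG Gx Gy]] := soft_barycenter_section cX hX sX.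
exists (fun u z => meas (G z) (test u)); split.
- by move=> u; exact: (continuous_o cG (@continuous_meas _ _ (test u))).
- move=> u x y ux uy; rewrite Gx pair_measE !testE !pair_measE !complE ux uy.
  by rewrite !maxxx subrr mulr0 mul0r maxxx.
- move=> u x y ux uy; rewrite Gy pair_measE !testE !pair_measE !complE ux uy.
  rewrite subrr subr0 !maxxx (max_idPl (@ler01 R)) (max_idPr (@ler01 R)) mul0r.
  by rewrite mulr1 (max_idPl (@ler01 R)).
- by move=> u v x y w ux uy; apply: meas_test_le.
Qed.

(** * Pseudometrics of finite families of functions *)

Section pseudodistance.
Variables (R : realType) (X : topologicalType).
Implicit Types (s t : seq (C01 R X)) (x y z : X).

Definition pdist s x y : R := \sum_(f <- s) `|set_val (f x) - set_val (f y)|.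

Lemma pdist_ge0 s x y : 0 <= pdist s x y.
Proof. by apply: sumr_ge0 => f _; exact: normr_ge0. Qed.

Lemma pdistxx s x : pdist s x x = 0.
Proof. by rewrite /pdist big1 // => f _; rewrite subrr normr0. Qed.

Lemma pdistC s x y : pdist s x y = pdist s y x.
Proof. by apply: eq_bigr => f _; rewrite distrC. Qed.

Lemma pdist_triangle s x y z : pdist s x z <= pdist s x y + pdist s y z.
Proof.
rewrite /pdist -big_split; apply: ler_sum => f _.
by rewrite -(subrKA (set_val (f y))) ler_normD.
Qed.

Lemma pdist_cat s t x y : pdist (s ++ t) x y = pdist s x y + pdist t x y.
Proof. by rewrite /pdist big_cat. Qed.

Lemma pdist_mem s (f : C01 R X) x y : f \in s ->
  `|set_val (f x) - set_val (f y)| <= pdist s x y.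
Proof.
elim: s => // g s IHs; rewrite inE /pdist big_cons => /predU1P[->|/IHs fs].
  by rewrite lerDl; exact: pdist_ge0.
by apply: le_trans fs _; rewrite lerDr.
Qed.

Lemma continuous_pdist s : continuous (fun p : X * X => pdist s p.1 p.2).
Proof.
elim: s => [|f s IHs].
  rewrite (_ : (fun p => _) = fun=> 0); first exact: cst_continuous.
  by apply/funext => p; rewrite /pdist big_nil.
rewrite (_ : (fun p => _) = fun p : X * X =>
  `|set_val (f p.1) - set_val (f p.2)| + pdist s p.1 p.2); last first.
  by apply/funext => p; rewrite /pdist big_cons.
have c1 := continuous_o (@continuous_fst X X) (@continuous_val _ _ f).
have c2 := continuous_o (@continuous_snd X X) (@continuous_val _ _ f).
move=> p; apply: (@continuousD _ R^o _
  (fun p : X * X => `|set_val (f p.1) - set_val (f p.2)|)); last exact: IHs.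
apply: (@continuous_o _ _ _ (fun p : X * X => set_val (f p.1) - set_val (f p.2))
  Num.norm); last exact: norm_continuous.
by move=> q; apply: (@continuousB _ R^o _ (fun p : X * X => set_val (f p.1))
  (fun p : X * X => set_val (f p.2))); [exact: c1 | exact: c2].
Qed.

Lemma continuous_pdistr s x : continuous (pdist s x).
Proof.
apply: (continuous_o (f := fun y => (x, y)) _ (@continuous_pdist s)).
by apply: continuous_pair => y; [exact: cst_continuous | exact: cvg_id].
Qed.

Hypotheses (cX : compact [set: X]) (hX : hausdorff_space X).

Let cXX : compact [set: X * X].
Proof. by rewrite -setXTT; exact: compact_setX. Qed.

(** A Urysohn function separating one pair also separates all nearby pairs, so compactness of [K]
    leaves finitely many. *)
Lemma separating_seq (K : set (X * X)) : closed K ->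
  (forall p, K p -> p.1 <> p.2) ->
  exists s, forall p, K p -> 0 < pdist s p.1 p.2.
Proof.
move=> clK Kd; have cK := subclosed_compact clK cXX (@subsetT _ K).
pose U (f : C01 R X) := [set p : X * X | 0 < pdist [:: f] p.1 p.2].
have oU f : open (U f) by apply: open_gt_fun; exact: continuous_pdist.
have KU p : K p -> exists f, U f p.
  move=> /Kd pd; have [f [f1 f0]] := hausdorff_separation R cX hX pd.
  by exists f; rewrite /U /= /pdist big_seq1 f1 f0 subr0 normr1.
have [s sK] := compact_finite_cover cK oU KU.
exists s => p /sK [f fs]; rewrite /U /= {1}/pdist big_seq1 => fp.
by apply: lt_le_trans fp _; exact: pdist_mem.
Qed.

Lemma separating_seqs (I : eqType) (l : seq I) (K : I -> set (X * X)) :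
  (forall i, i \in l -> closed (K i)) ->
  (forall i, i \in l -> forall p, K i p -> p.1 <> p.2) ->
  exists s, forall i, i \in l -> forall p, K i p -> 0 < pdist s p.1 p.2.
Proof.
elim: l => [|i l IHl] clK Kd; first by exists [::].
have [||s sl] := IHl.
- by move=> j jl; apply: clK; rewrite inE jl orbT.
- by move=> j jl; apply: Kd; rewrite inE jl orbT.
have il : i \in i :: l by rewrite mem_head.
have [t ti] := separating_seq (clK _ il) (Kd _ il).
exists (t ++ s) => j; rewrite inE => /predU1P[->|jl] p Kp; rewrite pdist_cat.
  by rewrite ltr_wpDr ?pdist_ge0 ?ti.
by rewrite ltr_wpDl ?pdist_ge0 // (sl j).
Qed.

Lemma separating_points (Q : seq X) :
  exists s, {in Q &, forall x y, x <> y -> 0 < pdist s x y}.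
Proof.
have [||s sP] := @separating_seqs (X * X)%type
    [seq p <- [seq (x, y) | x <- Q, y <- Q] | p.1 != p.2] (fun p => [set p]).
- move=> p _; apply: accessible_closed_set1; apply: hausdorff_accessible.
  exact: hausdorff_prod.
- by move=> p + q /= -> ; rewrite mem_filter => /andP[/eqP].
exists s => x y xQ yQ /eqP xy; apply: (sP (x, y) _ (x, y)) => //.
by rewrite mem_filter xy allpairs_f.
Qed.

(** Finitely many products of small balls cover [X * X]; one off-diagonal pair is picked in each
    that has one. For [a] and [b] that [s] does not separate, this gives two distinct points of [Q]
    close to [a]. *)
Lemma approximating_pairs s (eps : R) : 0 < eps -> exists Q : seq X,
  forall a b, a <> b -> exists p q,
    [/\ p \in Q, q \in Q, p <> q, pdist s a p < eps & pdist s b q < eps].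
Proof.
move=> eps0; have eps20 : 0 < eps / 2 by lra.
pose U (i : X * X) := [set p : X * X |
  pdist s i.1 p.1 < eps / 2 /\ pdist s i.2 p.2 < eps / 2].
have oU i : open (U i).
  apply: openI; apply: open_lt_fun.
    exact: (continuous_o (@continuous_fst X X) (@continuous_pdistr s i.1)).
  exact: (continuous_o (@continuous_snd X X) (@continuous_pdistr s i.2)).
have Ucov p : [set: X * X] p -> exists i, U i p.
  by exists p; split; rewrite pdistxx.
have [l lP] := compact_finite_cover cXX oU Ucov.
(* A box without off-diagonal pairs gets its centre as a default; it contains no pair [(a, b)] with
   [a <> b]. *)
have /choice [c cP] i : exists p : X * X, (exists q, U i q /\ q.1 <> q.2) ->
    U i p /\ p.1 <> p.2.
  by have [[q qP]|nq] := pselect (exists q, U i q /\ q.1 <> q.2);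
    [exists q | exists i].
exists ([seq (c i).1 | i <- l] ++ [seq (c i).2 | i <- l]) => a b ab.
have [i il Ui] := lP (a, b) I.
have [[c1 c2] cd] := cP i (ex_intro _ (a, b) (conj Ui ab)).
have [a1 b2] := Ui.
exists (c i).1, (c i).2; split=> //.
- by rewrite mem_cat; apply/orP; left; apply/mapP; exists i.
- by rewrite mem_cat; apply/orP; right; apply/mapP; exists i.
- apply: le_lt_trans (pdist_triangle s a i.1 _) _.
  by rewrite (pdistC s a) /= in a1 *; lra.
- apply: le_lt_trans (pdist_triangle s b i.2 _) _.
  by rewrite (pdistC s b) /= in b2 *; lra.
Qed.

End pseudodistance.

(** * Closing off countably many functions and points *)

Lemma inv_succ_lt (R : archiRealFieldType) (r : R) :
  0 < r -> exists N, forall n, (N <= n)%N -> n.+1%:R^-1 < r.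
Proof.
move=> r0; have [N _ NP] := near_infty_natSinv_lt (PosNum r0).
by exists N.
Qed.

Section closing_off.
Variables (R : realType) (X : topologicalType).
Hypotheses (cX : compact [set: X]) (hX : hausdorff_space X).
Variable e : C01 R X -> X * X * X -> R.
Hypothesis e_continuous : forall u : C01 R X, continuous (e u).
Hypothesis e_left : forall (u : C01 R X) x y,
  set_val (u x) = 1 -> set_val (u y) = 0 -> e u (x, y, x) = 0.
Hypothesis e_right : forall (u : C01 R X) x y,
  set_val (u x) = 1 -> set_val (u y) = 0 -> e u (x, y, y) = 1.
Hypothesis e_comparable : forall (u v : C01 R X) x y w,
  set_val (u x) = set_val (v x) -> set_val (u y) = set_val (v y) ->
  e u (x, y, w) / 4 <= e v (x, y, w).

Lemma cutoff_subproof (s : seq (C01 R X)) (r : R) (q : X) :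
  continuous (fun x => r^-1 * pdist s q x).
Proof.
move=> x; apply: (@continuousM R X (fun=> r^-1) (pdist s q)).
  exact: cst_continuous.
exact: continuous_pdistr.
Qed.

(** It is 0 at [q] and 1 at distance at least [r] from [q]. Being built from [s] alone, it gives
    only finitely many functions for the points of one stage. *)
Definition cutoff s r q : C01 R X := clamp_fun (@cutoff_subproof s r q).

Lemma cutoff0 s r q : set_val (cutoff s r q q) = 0.
Proof.
change (Num.max 0 (Num.min 1 (r^-1 * pdist s q q)) = 0).
by rewrite pdistxx mulr0 (min_idPr (@ler01 R)) maxxx.
Qed.

Lemma cutoff1 s r q x : 0 < r -> r <= pdist s q x ->
  set_val (cutoff s r q x) = 1.
Proof.
move=> r0 rq; change (Num.max 0 (Num.min 1 (r^-1 * pdist s q x)) = 1).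
have le1 : 1 <= r^-1 * pdist s q x by rewrite ler_pdivlMl ?mulr1.
by rewrite (min_idPl le1) (max_idPr (@ler01 R)).
Qed.

Definition stage := (seq (C01 R X) * seq X)%type.

(** The threshold in the last clause is one half, which continuity will provide near a value 1,
    divided by the factor 4 of [e_comparable]. *)
Definition next_stage (r : R) (st st' : stage) : Prop :=
  [/\ exists t, st'.1 = st.1 ++ t,
      {subset st.2 <= st'.2},
      forall a b, a <> b -> exists p q,
        [/\ p \in st'.2, q \in st'.2, p <> q,
            pdist st.1 a p < r & pdist st.1 b q < r],
      {in st'.2 &, forall p q, p <> q -> 0 < pdist st'.1 p q} &
      {in st.2, forall q x w, r <= pdist st.1 q x ->
        8^-1 <= e (cutoff st.1 r q) (x, q, w) -> 0 < pdist st'.1 x w}].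

(** The pairs to be separated by the last clause form a closed set since [e] is continuous, and it
    misses the diagonal because [e_left] gives 0 there. *)
Lemma next_stage_exists (r : R) (st : stage) : 0 < r ->
  exists st', next_stage r st st'.
Proof.
move=> r0; case: st => s Q.
have [Q1 Q1P] := approximating_pairs cX s r0.
have [t tP] := separating_points R cX hX (Q ++ Q1).
pose K q := [set p : X * X | r <= pdist s q p.1 /\
  8^-1 <= e (cutoff s r q) (p.1, q, p.2)].
have clK q : q \in Q -> closed (K q).
  move=> _; apply: closedI; apply: closed_ge_fun.
    exact: (continuous_o (@continuous_fst X X) (@continuous_pdistr _ _ s q)).
  apply: (continuous_o _ (@e_continuous (cutoff s r q))).
  apply: continuous_pair; last exact: continuous_snd.
  apply: continuous_pair; first exact: continuous_fst.
  by move=> p; exact: cst_continuous.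
have Kd q : q \in Q -> forall p, K q p -> p.1 <> p.2.
  move=> _ [x w] [/= rx + xw]; rewrite -xw e_left ?cutoff0 ?cutoff1 //.
  by rewrite leNgt invr_gt0 ltr0n.
have [v vP] := separating_seqs R cX hX clK Kd.
exists (s ++ t ++ v, Q ++ Q1); split=> /=.
- by exists (t ++ v).
- by move=> q qQ; rewrite mem_cat qQ.
- move=> a b /Q1P [p [q [pQ qQ pq ap bq]]]; exists p, q.
  by rewrite !mem_cat pQ qQ !orbT.
- move=> p q pQ qQ pq; rewrite !pdist_cat ltr_wpDl ?pdist_ge0 //.
  by rewrite ltr_wpDr ?pdist_ge0 // tP.
- move=> q qQ x w rx ew; rewrite !pdist_cat addrA ltr_wpDl //.
    by rewrite addr_ge0 ?pdist_ge0.
  exact: (vP q qQ (x, w)).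
Qed.

Lemma stages_exist : exists st : nat -> stage,
  forall k, next_stage k.+1%:R^-1 (st k) (st k.+1).
Proof.
have /choice [f fP] (ks : nat * stage) :
    exists st', next_stage ks.1.+1%:R^-1 ks.2 st'.
  by apply: next_stage_exists; rewrite invr_gt0 ltr0n.
pose st := fix st k := if k is k'.+1 then f (k', st k') else ([::], [::]) : stage.
by exists st => k; exact: (fP (k, st k)).
Qed.

(** * Points that no stage separates coincide *)

Section limit.
Variable st : nat -> stage.
Hypothesis stP : forall k, next_stage k.+1%:R^-1 (st k) (st k.+1).
Let D k := pdist (st k).1.

Lemma stage_pdist_le k n x y : (k <= n)%N -> D k x y <= D n x y.
Proof.
elim: n => [|n IHn]; first by rewrite leqn0 => /eqP ->.
rewrite leq_eqVlt => /predU1P[-> //|]; rewrite ltnS => /IHn le.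
apply: le_trans le _; have [[t tE] _ _ _ _] := stP n.
by rewrite /D tE pdist_cat lerDl pdist_ge0.
Qed.

Lemma stage_points_sub k n : (k <= n)%N -> {subset (st k).2 <= (st n).2}.
Proof.
elim: n => [|n IHn]; first by rewrite leqn0 => /eqP ->.
rewrite leq_eqVlt => /predU1P[-> //|]; rewrite ltnS => /IHn le q /le.
by have [_ + _ _ _] := stP n; apply.
Qed.

(* Otherwise [e] at [(y, q n, z)] is close to [e] at [(y, z, z)], and since some
   stage separates [q n] from [y], a later stage separates [y] from [z]. *)
Lemma stage_limit_unique a y z (q : nat -> X) :
  (forall n, q n \in (st n.+1).2) ->
  (forall n, exists m, 0 < D m a (q n)) ->
  (forall B, nbhs z B -> exists n, B (q n)) ->
  (forall k, D k a y = 0) -> (forall k, D k a z = 0) -> y = z.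
Proof.
move=> qst qa qz ay az; apply: contrapT => yz.
have [f [fy fz]] := hausdorff_separation R cX hX yz.
(* Truncating [2 * f - 1] gives a function that is 1 at [y] and 0 on a whole neighbourhood of [z],
   hence at [q n] as well. *)
have cg : continuous (fun x => 2 * set_val (f x) - 1).
  move=> x; apply: (@continuousB _ R^o _ (fun x => 2 * set_val (f x)) (fun=> 1));
    last exact: cst_continuous.
  apply: (@continuousM R X (fun=> 2) (fun x => set_val (f x))).
    exact: cst_continuous.
  exact: continuous_val.
pose u := clamp_fun cg.
have uE x : set_val (u x) = Num.max 0 (Num.min 1 (2 * set_val (f x) - 1)) by [].
have uy : set_val (u y) = 1.
  by rewrite uE fy (_ : 2 * 1 - 1 = 1) ?minxx ?(max_idPr (@ler01 R)) //; lra.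
have u0 x : set_val (f x) < 2^-1 -> set_val (u x) = 0.
  move=> fx; rewrite uE; apply/max_idPl; rewrite ge_min; apply/orP; right; lra.
have cey : continuous (fun x => e u (y, x, z)).
  apply: (continuous_o _ (@e_continuous u)).
  apply: continuous_pair; last by move=> p; exact: cst_continuous.
  by apply: continuous_pair => p; [exact: cst_continuous | exact: cvg_id].
have [|n [/= fq eq]] := qz ([set x | set_val (f x) < 2^-1] `&`
    [set x | 2^-1 < e u (y, x, z)]).
  apply: filterI; apply: open_nbhs_nbhs; split.
  - apply: open_lt_fun; exact: continuous_val.
  - by rewrite /= fz invr_gt0.
  - exact: open_gt_fun.
  - by rewrite /= e_right //; [lra | rewrite u0 // fz invr_gt0].
have [m mq] := qa n; have [N NP] := inv_succ_lt mq.
(* At stage [M] the point [q n] is listed, and its distance from [a] exceeds the radius used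
   there. *)
pose M := maxn N (maxn m n.+1).
have Mn : (n < M)%N by rewrite !leq_max leqnn !orbT.
have Mm : (m <= M)%N by rewrite !leq_max leqnn !orbT.
have MN : (N <= M)%N by rewrite !leq_max leqnn.
have qM : q n \in (st M).2 by exact: (stage_points_sub Mn).
have Mr0 : 0 < M.+1%:R^-1 :> R by rewrite invr_gt0 ltr0n.
have Mq : M.+1%:R^-1 <= D M (q n) y.
  have := NP M MN; have := stage_pdist_le a (q n) Mm.
  have := pdist_triangle (st M).1 a y (q n); rewrite (pdistC _ y) -/(D M) ay.
  rewrite add0r => le1 le2 lt; exact: le_trans (ltW lt) (le_trans le2 le1).
have [_ _ _ _ /(_ _ qM y z Mq)] := stP M.
(* Both functions are 1 at [y] and 0 at [q n], so the bound for [u] passes to the cutoff, which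
   stage [M] does take into account. *)
have ec := @e_comparable u (cutoff (st M).1 M.+1%:R^-1 (q n)) y (q n) z.
rewrite uy cutoff1 // u0 // cutoff0 in ec.
have {}ec := ec erefl erefl.
have e8 : 8^-1 <= e (cutoff (st M).1 M.+1%:R^-1 (q n)) (y, q n, z) by lra.
move=> /(_ e8); rewrite -/(D M.+1).
have := pdist_triangle (st M.+1).1 y a z; rewrite (pdistC _ y a) -/(D M.+1).
by rewrite ay az; lra.
Qed.

(** Otherwise points [q k] outside the class of [a] approach it. They cluster at some [z], which
    lies in the class, and [stage_limit_unique] identifies both [a] and [b] with [z]. *)
Lemma stages_separate a b : (forall k, D k a b = 0) -> a = b.
Proof.
move=> ab; apply: contrapT => nab.
have /choice [q qP] k : exists q,
    [/\ q \in (st k.+1).2, D k a q < k.+1%:R^-1 & exists m, 0 < D m a q].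
  have [_ _ /(_ _ _ nab) [p [p' [pQ pQ' pp' ap bp']]] sep _] := stP k.
  have ap' : D k a p' < k.+1%:R^-1.
    have := pdist_triangle (st k).1 a b p'; rewrite -/(D k) ab add0r => le.
    exact: le_lt_trans le bp'.
  (* The next stage separates [p] from [p'], so it cannot put both at distance 0 from [a]. *)
  have lt := sep p p' pQ pQ' pp'; rewrite -/(D k.+1) in lt.
  have [lt1|le1] := ltP 0 (D k.+1 a p); first by exists p; split=> //; exists k.+1.
  exists p'; split=> //; exists k.+1.
  have := pdist_triangle (st k.+1).1 p a p'; rewrite (pdistC _ p a) -/(D k.+1).
  lra.
have qF := fmap_proper_filter q eventually_filter.
have [z [_ zq]] := @cX _ qF (@filterT _ _ qF).
have cl B k : nbhs z B -> exists2 n, (k <= n)%N & B (q n).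
  move=> zB.
  have [|x [[n kn <-] Bx]] := zq [set q n | n in [set n | (k <= n)%N]] B _ zB.
    by exists k => // n /= kn; exists n.
  by exists n.
(* For [n >= j], [D j a (q n) <= D n a (q n)], which is below [1 / (n + 1)]; a positive limit value
   is thus excluded. *)
have az j : D j a z = 0.
  apply/eqP; rewrite eq_le pdist_ge0 andbT leNgt; apply/negP => az0.
  have az2 : 0 < D j a z / 2 by rewrite divr_gt0.
  have [N NP] := inv_succ_lt az2.
  have [|n] := cl [set x | D j a z / 2 < D j a x] (maxn N j).
    apply: open_nbhs_nbhs; split; first exact/open_gt_fun/continuous_pdistr.
    by rewrite /= ltr_pdivrMr // ltr_pMr // ltr1n.
  rewrite geq_max => /andP[Nn jn] /=.
  have [_ lt _] := qP n.
  have := lt_trans (le_lt_trans (stage_pdist_le a (q n) jn) lt) (NP n Nn).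
  by move=> lt1 lt2; have := lt_trans lt1 lt2; rewrite ltxx.
have qst n : q n \in (st n.+1).2 by have [] := qP n.
have qa n : exists m, 0 < D m a (q n) by have [] := qP n.
have qz B : nbhs z B -> exists n, B (q n) by move=> /(cl B 0%N) [n]; exists n.
have aa k : D k a a = 0 by exact: pdistxx.
apply: nab; rewrite (stage_limit_unique qst qa qz aa az).
by rewrite (stage_limit_unique qst qa qz ab az).
Qed.

End limit.
End closing_off.

(** * A metric from an increasing sequence of pseudometrics *)

Section metric_of_pseudometrics.
Variables (R : realType) (X : topologicalType) (D : nat -> X -> X -> R).
Hypothesis cX : compact [set: X].
Hypothesis D_ge0 : forall k x y, 0 <= D k x y.
Hypothesis Dxx : forall k x, D k x x = 0.
Hypothesis DC : forall k x y, D k x y = D k y x.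
Hypothesis D_triangle : forall k x y z, D k x z <= D k x y + D k y z.
Hypothesis D_mono : forall k n x y, (k <= n)%N -> D k x y <= D n x y.
Hypothesis D_continuous : forall k x, continuous (D k x).
Hypothesis D_separates : forall x y, (forall k, D k x y = 0) -> x = y.

(** The truncation leaves only finitely many pseudometrics relevant to a given radius, so balls of
    the supremum are neighbourhoods. *)
Let m k x y := Num.min (D k x y) k.+1%:R^-1.

Definition sup_dist x y : R := sup (range (fun k => m k x y)).

Lemma inv_succ_gt0 k : 0 < k.+1%:R^-1 :> R.
Proof. by rewrite invr_gt0 ltr0n. Qed.

Lemma le_sup_dist k x y : m k x y <= sup_dist x y.
Proof.
apply: ub_le_sup; last by exists k.
exists 1 => _ [n _ <-]; rewrite ge_min; apply/orP; right.
by rewrite invf_le1 ?ltr0n // ler1n.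
Qed.

Lemma sup_dist_le x y r : (forall k, m k x y <= r) -> sup_dist x y <= r.
Proof.
by move=> mr; apply: ge_sup; [exists (m 0%N x y), 0%N | move=> _ [k _ <-]].
Qed.

Lemma sup_dist_eq0 x y : sup_dist x y = 0 <-> x = y.
Proof.
split=> [d0|->].
  apply: D_separates => k; have := le_sup_dist k x y.
  rewrite d0 ge_min leNgt [X in _ || X]leNgt inv_succ_gt0 orbF -leNgt => le0.
  by apply/eqP; rewrite eq_le le0 D_ge0.
have m0 k : m k y y = 0 by rewrite /m Dxx; apply/min_idPl; exact/ltW/inv_succ_gt0.
apply/eqP; rewrite eq_le -{2}(m0 0%N) le_sup_dist andbT.
by apply: sup_dist_le => k; rewrite m0.
Qed.

Lemma sup_distC x y : sup_dist x y = sup_dist y x.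
Proof.
have E : (fun k => m k x y) = (fun k => m k y x)
  by apply/funext => k; rewrite /m DC.
by rewrite /sup_dist E.
Qed.

Lemma sup_dist_triangle x y z : sup_dist x z <= sup_dist x y + sup_dist y z.
Proof.
apply: sup_dist_le => k.
apply: le_trans (lerD (le_sup_dist k x y) (le_sup_dist k y z)).
have := D_triangle k x y z; have := D_ge0 k x y; have := D_ge0 k y z.
rewrite /m; have := inv_succ_gt0 k; move: (k.+1%:R^-1) => r r0.
rewrite ge_min /Num.min; do 2 case: ifP => _; move=> *; apply/orP;
  try (by left; lra); by right; lra.
Qed.

Lemma nbhs_sup_dist x :
  nbhs x = nbhs_ball_ (fun x e => [set y | sup_dist x y < e]) x.
Proof.
apply/seteqP; split=> U.
  rewrite nbhsE => -[V [oV Vx] VU].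
  have cV : compact (~` V).
    exact: (subclosed_compact (open_closedC oV) cX (@subsetT _ _)).
  pose W k := [set y | k.+1%:R^-1 < D k x y].
  have oW k : open (W k) by apply: open_gt_fun; exact: D_continuous.
  have VW y : (~` V) y -> exists k, W k y.
    move=> Vy; apply: contrapT => nW; apply: Vy; rewrite -(_ : x = y) //.
    apply: D_separates => j; apply/eqP; rewrite eq_le D_ge0 andbT leNgt.
    apply/negP => /[dup] Dj /inv_succ_lt [N NP]; apply: nW; exists (maxn N j).
    apply: lt_le_trans (NP _ (leq_maxl _ _)) _.
    by apply: D_mono; exact: leq_maxr.
  (* By monotonicity the largest index [M] controls the finite subcover: in the ball of radius
     [1 / (M + 1)] the truncation of [D M] is inactive, so the ball misses every [W k] with [k] in
     [s]. *)
  have [s sP] := compact_finite_cover cV oW VW.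
  pose M := \max_(k <- s) k.
  exists M.+1%:R^-1; first exact: inv_succ_gt0.
  move=> y /= yM; apply: VU; apply: contrapT => /sP [k ks]; rewrite /W /=.
  have kM : (k <= M)%N by apply: (@leq_bigmax_seq _ s xpredT id).
  apply/negP; rewrite -leNgt; have := le_lt_trans (le_sup_dist M x y) yM.
  rewrite gt_min ltxx orbF => /ltW DM; apply: le_trans (D_mono x y kM) _.
  by apply: le_trans DM _; rewrite lef_pV2 ?posrE ?ltr0n // ler_nat.
move=> [r /= r0 rU]; apply: filterS rU _.
have r20 : 0 < r / 2 by rewrite divr_gt0.
have [N NP] := inv_succ_lt r20.
have nD : nbhs x [set y | D N x y < r / 2].
  apply: open_nbhs_nbhs; split; last by rewrite /= Dxx.
  exact/open_lt_fun/D_continuous.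
apply: filterS nD => y /= DN; apply: (@le_lt_trans _ _ (r / 2)); last lra.
(* Indices up to [N] are bounded through [D N], the others through the truncation. *)
apply: sup_dist_le => k; rewrite ge_min.
have [kN|/ltnW Nk] := leqP k N; apply/orP; [left|right].
  exact: le_trans (D_mono x y kN) (ltW DN).
exact/ltW/NP.
Qed.

Lemma metrizable_of_pseudometrics : metrizable R X.
Proof.
exists sup_dist; split.
- exact: sup_dist_eq0.
- exact: sup_distC.
- exact: sup_dist_triangle.
- exact: nbhs_sup_dist.
Qed.

End metric_of_pseudometrics.

Theorem theorem5 (R : realType) (X : topologicalType)
  (cptX : compact [set: X]) (hsdfX : hausdorff_space X)
  (softX : soft (barycenter_map R X)) : metrizable R X.
Proof.
have [e [ce el er ecmp]] := soft_barycenter_kernel cptX hsdfX softX.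
have [st stP] := stages_exist cptX hsdfX ce el.
apply: (@metrizable_of_pseudometrics R X (fun k => pdist (st k).1)) => //.
- by move=> k x y; exact: pdist_ge0.
- by move=> k x; exact: pdistxx.
- by move=> k x y; exact: pdistC.
- by move=> k x y z; exact: pdist_triangle.
- by move=> k n x y; exact: (stage_pdist_le stP).
- by move=> k x; exact: continuous_pdistr.
- by move=> x y; exact: (stages_separate cptX hsdfX ce er ecmp stP).
Qed.
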